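(* Let $m=2+12q$ with $q=1+2d$ for a nonnegative integer $d$, and let $t=t(q)$. The minimal decomposition of $\mathbb{Z}_2$ for the Fibonacci polynomial $F_m$ is $$\mathbb{Z}_2=\{0\}\sqcup\Bigl(\bigl(\bigcup_{k=0}^{3}A_k\bigr)\cup\bigl(\bigcup_{n\ge 1}\bigcup_{k=0}^{2^{t+1}-1}M_{n,k}\bigr)\Bigr),$$ where $A_k=1+2k+2^3\mathbb{Z}_2$ and $$M_{n,k}=\bigl((1+4k)2^n+2^{n+t+3}\mathbb{Z}_2\bigr)\cup\bigl((2^{t+2}-1-4k)2^n+2^{n+t+3}\mathbb{Z}_2\bigr).$$ Here $\{0\}$ is the set of a fixed point, and the $A_k$'s and $M_{n,k}$'s are the minimal components.
   Context: $\mathbb{Z}_2$ is the ring of 2-adic integers with the 2-adic metric. The Fibonacci polynomials are defined by $F_0(x)=0$, $F_1(x)=1$, $F_m(x)=xF_{m-1}(x)+F_{m-2}(x)$ for $m\ge 2$. For a nonnegative integer $q$ with binary expansion $q=\sum_{i\ge 0}c_i2^i$, $c_i\in\{0,1\}$ (with $c_i=0$ for all large $i$), define $t(q)=\min\{i\ge 0: c_i=c_{i+1}\}$. For a polynomial $f$ over $\mathbb{Z}_2$, a minimal decomposition of $\mathbb{Z}_2$ for $f$ is a decomposition $\mathbb{Z}_2=\mathcal P\sqcup\mathcal M\sqcup\mathcal B$ (some parts possibly empty) in which: $\mathcal P$ is the finite set consisting of all periodic points of $f$; $\mathcal M=\bigsqcup_i\mathcal M_i$ is the union of all (at most countably many)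 clopen $f$-invariant sets $\mathcal M_i$ (the minimal components), each a finite union of balls, such that each $f:\mathcal M_i\to\mathcal M_i$ is minimal (every orbit is dense in $\mathcal M_i$); and each point of $\mathcal B$ lies in the attracting basin of a periodic orbit or of a minimal subsystem. *)

(* Defs.v *)
From HB Require Import structures.
From mathcomp Require Import all_boot all_order all_algebra.
From mathcomp Require Import all_classical all_reals all_analysis.

Set Implicit Arguments.
Unset Strict Implicit.
Unset Printing Implicit Defensive.

Import Order.TTheory GRing.Theory Num.Theory.

Local Open Scope classical_set_scope.
Local Open Scope ring_scope.

(* Z_2 as the inverse limit of the rings Z/2^n: [residue x n] is the
   representative in {0, ..., 2^n - 1} of x modulo 2^n.  (MathComp's ['Z_2]
   is Z/2Z.) *)
Record Z2adic : Type := MkZ2adic {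
  residue : nat -> nat;
  residue_coh : forall n, (residue n.+1 %% 2 ^ n)%N = residue n }.

HB.instance Definition _ := gen_eqMixin Z2adic.
HB.instance Definition _ := gen_choiceMixin Z2adic.

Lemma Z2adic_ext (x y : Z2adic) : (forall n, residue x n = residue y n) -> x = y.
Proof.
case: x y => [r rP] [s sP] /= /funext rs; case: s / rs sP => sP.
by rewrite (Prop_irrelevance rP sP).
Qed.

Lemma residue_mod (x : Z2adic) n : (residue x n %% 2 ^ n)%N = residue x n.
Proof. by rewrite -residue_coh modn_mod. Qed.

Lemma residue_lt (x : Z2adic) n : (residue x n < 2 ^ n)%N.
Proof. by rewrite -residue_mod ltn_mod expn_gt0. Qed.

Lemma residueS (x : Z2adic) n : residue x n.+1 = residue x n %[mod 2 ^ n].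
Proof. by rewrite residue_coh residue_mod. Qed.

Lemma of_seq_subproof (f : nat -> nat) :
  (forall n, f n.+1 = f n %[mod 2 ^ n]) ->
  forall n, ((f n.+1 %% 2 ^ n.+1) %% 2 ^ n = f n %% 2 ^ n)%N.
Proof. by move=> fP n; rewrite modn_dvdm ?fP// dvdn_exp2l. Qed.

Definition of_seq (f : nat -> nat) (fP : forall n, f n.+1 = f n %[mod 2 ^ n]) :=
  @MkZ2adic (fun n => f n %% 2 ^ n)%N (of_seq_subproof fP).

Lemma cst_subproof (c n : nat) : c = c %[mod 2 ^ n].
Proof. by []. Qed.

Lemma add_subproof (x y : Z2adic) n :
  (residue x n.+1 + residue y n.+1 = residue x n + residue y n %[mod 2 ^ n])%N.
Proof. by rewrite -modnDm !residueS modnDm. Qed.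

Lemma mul_subproof (x y : Z2adic) n :
  (residue x n.+1 * residue y n.+1 = residue x n * residue y n %[mod 2 ^ n])%N.
Proof. by rewrite -modnMm !residueS modnMm. Qed.

Lemma opp_subproof (x : Z2adic) n :
  (2 ^ n.+1 - residue x n.+1 = 2 ^ n - residue x n %[mod 2 ^ n])%N.
Proof.
apply/eqP; rewrite -(eqn_modDr (residue x n.+1)) subnK 1?ltnW ?residue_lt//.
rewrite -modnDmr residueS modnDmr subnK 1?ltnW ?residue_lt// modnn.
by rewrite expnS modnMl.
Qed.

Definition zero2 := of_seq (cst_subproof 0).
Definition one2 := of_seq (cst_subproof 1).
Definition add2 x y := of_seq (add_subproof x y).
Definition mul2 x y := of_seq (mul_subproof x y).
Definition opp2 x := of_seq (opp_subproof x).

Lemma add2A : associative add2.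
Proof. by move=> x y z; apply: Z2adic_ext => n /=; rewrite modnDml modnDmr addnA. Qed.

Lemma add2C : commutative add2.
Proof. by move=> x y; apply: Z2adic_ext => n /=; rewrite addnC. Qed.

Lemma add02 : left_id zero2 add2.
Proof. by move=> x; apply: Z2adic_ext => n /=; rewrite mod0n add0n residue_mod. Qed.

Lemma addN2 : left_inverse zero2 opp2 add2.
Proof.
move=> x; apply: Z2adic_ext => n /=.
by rewrite modnDml subnK 1?ltnW ?residue_lt// modnn mod0n.
Qed.

Lemma mul2A : associative mul2.
Proof. by move=> x y z; apply: Z2adic_ext => n /=; rewrite modnMml modnMmr mulnA. Qed.

Lemma mul2C : commutative mul2.
Proof. by move=> x y; apply: Z2adic_ext => n /=; rewrite mulnC. Qed.

Lemma mul12 : left_id one2 mul2.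
Proof. by move=> x; apply: Z2adic_ext => n /=; rewrite modnMml mul1n residue_mod. Qed.

Lemma mul2D : left_distributive mul2 add2.
Proof.
by move=> x y z; apply: Z2adic_ext => n /=; rewrite modnMml mulnDl modnDm.
Qed.

Lemma one2_neq0 : one2 != zero2.
Proof. by apply/eqP => /(congr1 (residue^~ 1%N)). Qed.

HB.instance Definition _ := GRing.isZmodule.Build Z2adic add2A add2C add02 addN2.
HB.instance Definition _ :=
  GRing.Zmodule_isComNzRing.Build Z2adic mul2A mul2C mul12 mul2D one2_neq0.

Lemma residue0 n : residue 0 n = 0%N.
Proof. exact: mod0n. Qed.

Lemma residueD (x y : Z2adic) n :
  residue (x + y) n = ((residue x n + residue y n) %% 2 ^ n)%N.
Proof. by []. Qed.

Lemma residueN (x : Z2adic) n : residue (- x) n = ((2 ^ n - residue x n) %% 2 ^ n)%N.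
Proof. by []. Qed.

Lemma residueM (x y : Z2adic) n :
  residue (x * y) n = ((residue x n * residue y n) %% 2 ^ n)%N.
Proof. by []. Qed.

Lemma residue_neq0_ex (x : Z2adic) : x != 0 -> exists n, residue x n.+1 != 0%N.
Proof.
move=> x0; apply: contrapT => h; move/eqP: x0; apply; apply: Z2adic_ext => n.
rewrite residue0 -residue_coh; have [->|nz] := eqVneq (residue x n.+1) 0%N.
  by rewrite mod0n.
by exfalso; apply: h; exists n.
Qed.

(* The largest n with 2^n | x; the value at 0 is irrelevant. *)
Definition val2 (x : Z2adic) : nat :=
  if pselect (x != 0) is left x0 then ex_minn (residue_neq0_ex x0) else 0%N.

Definition norm2 (x : Z2adic) : rat := if x == 0 then 0 else 2 ^- val2 x.

Definition dist2 (x y : Z2adic) : rat := norm2 (x - y).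

Lemma residue_le0 (x : Z2adic) m n :
  (m <= n)%N -> residue x n = 0%N -> residue x m = 0%N.
Proof.
by elim: n => [|n IH]; [rewrite leqn0 => /eqP-> |
  rewrite leq_eqVlt => /orP[/eqP->//|mn] xn; apply: IH => //;
  rewrite -residue_coh xn mod0n].
Qed.

Lemma val2P (x : Z2adic) n : x != 0 -> (n <= val2 x)%N = (residue x n == 0%N).
Proof.
move=> x0; rewrite /val2; case: pselect => [x0'|]; last by rewrite x0.
case: ex_minnP => v vP vmin; apply/idP/eqP => [|xn].
  case: n => [_|n nv]; first by have := residue_lt x 0; case: residue.
  apply/eqP; apply: contraTT nv => /vmin; by rewrite -leqNgt.
rewrite leqNgt; apply: contraNN vP => vn; apply/eqP; exact: residue_le0 vn xn.
Qed.

Lemma norm2_le (x : Z2adic) n : (norm2 x <= 2 ^- n) = (residue x n == 0%N).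
Proof.
rewrite /norm2; case: eqVneq => [->|x0].
  by rewrite residue0 eqxx invr_ge0 exprn_ge0.
by rewrite lef_pV2 ?posrE ?exprn_gt0// ler_eXn2l// val2P.
Qed.

Lemma norm2_ge0 x : 0 <= norm2 x.
Proof. by rewrite /norm2; case: ifP => // _; rewrite invr_ge0 exprn_ge0. Qed.

Lemma norm20 : norm2 0 = 0.
Proof. by rewrite /norm2 eqxx. Qed.

Lemma norm2_eq0 x : norm2 x = 0 -> x = 0.
Proof.
rewrite /norm2; case: eqVneq => // _ /eqP.
by rewrite invr_eq0 expf_eq0 pnatr_eq0 andbF.
Qed.

Lemma norm2_ultra x y : norm2 (x + y) <= Num.max (norm2 x) (norm2 y).
Proof.
wlog xy : x y / norm2 x <= norm2 y.
  move=> h; have [|/ltW] := leP (norm2 x) (norm2 y).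
    by move=> xy; rewrite -(max_r xy); exact: h.
  by move=> yx; rewrite -(max_r yx) addrC; exact: h.
rewrite (max_r xy); have [y0|y0] := eqVneq y 0.
  move: xy; rewrite y0 norm20 => x0; suff -> : x = 0 by rewrite addr0 norm20.
  by apply: norm2_eq0; apply/eqP; rewrite eq_le x0 norm2_ge0.
have ny : norm2 y = 2 ^- val2 y by rewrite /norm2 (negbTE y0).
have /eqP xk : residue x (val2 y) == 0%N by rewrite -norm2_le -ny.
have /eqP yk : residue y (val2 y) == 0%N by rewrite -norm2_le -ny.
by rewrite ny norm2_le residueD xk yk addn0 mod0n.
Qed.

Lemma norm2N x : norm2 (- x) = norm2 x.
Proof.
suff h z : norm2 (- z) <= norm2 z.
  by apply/eqP; rewrite eq_le h/= -{1}(opprK x) h.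
have [->|z0] := eqVneq z 0; first by rewrite oppr0.
have nz : norm2 z = 2 ^- val2 z by rewrite /norm2 (negbTE z0).
have /eqP zk : residue z (val2 z) == 0%N by rewrite -norm2_le -nz.
by rewrite nz norm2_le residueN zk subn0 modnn.
Qed.

Lemma dist2xx x : dist2 x x = 0.
Proof. by rewrite /dist2 subrr norm20. Qed.

Lemma dist2_positivity x y : dist2 x y = 0 -> x = y.
Proof. by move=> /norm2_eq0/subr0_eq. Qed.

Lemma dist2_sym x y : dist2 x y = dist2 y x.
Proof. by rewrite /dist2 -norm2N opprB. Qed.

Lemma dist2_triangle y x z : dist2 x z <= dist2 x y + dist2 y z.
Proof.
rewrite /dist2 -(subrKA y x); apply: (le_trans (norm2_ultra _ _)).
by rewrite ge_max lerDl lerDr !norm2_ge0.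
Qed.

(* The 2-adic distance only takes rational values, so [rat] is used as the
   scalar field of the metric structure. *)
HB.instance Definition _ :=
  isMetric.Build rat Z2adic dist2xx dist2_positivity dist2_sym dist2_triangle.

Section dynamics.
Variable f : Z2adic -> Z2adic.

Definition orbit2 (x : Z2adic) : set Z2adic := range (fun n => iter n f x).

Definition periodic_points : set Z2adic :=
  [set x | exists2 n, (0 < n)%N & iter n f x = x].

Definition finite_union_of_balls (E : set Z2adic) : Prop :=
  exists2 s : seq (Z2adic * rat), (forall b, b \in s -> 0 < b.2) &
    E = \bigcup_(b in [set` s]) ball b.1 b.2.

Definition minimal_component (E : set Z2adic) : Prop :=
  [/\ E !=set0, clopen E, finite_union_of_balls E, f @` E `<=` E &
      forall x, E x -> E `<=` closure (orbit2 x)].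

Definition attracting_basin (S : set Z2adic) : set Z2adic :=
  [set x | forall e : rat, 0 < e ->
     \forall n \near \oo, exists2 y, S y & ball y e (iter n f x)].

End dynamics.

Definition minimal_decomposition (f : {poly Z2adic}) (P : set Z2adic)
    (I : Type) (D : set I) (M : I -> set Z2adic) (B : set Z2adic) : Prop :=
  let F := horner f in
  let MM := \bigcup_(i in D) M i in
  [/\ [/\ [set: Z2adic] = P `|` MM `|` B,
          P `&` MM = set0, P `&` B = set0 & MM `&` B = set0],
      P = periodic_points F /\ finite_set P,
      [/\ countable D, trivIset D M, forall i, D i -> minimal_component F (M i) &
          forall E, minimal_component F E -> exists2 i, D i & E = M i] &
      forall x, B x ->
        (exists2 p, periodic_points F p & attracting_basin F (orbit2 F p) x) \/
        (exists2 i, D i & attracting_basin F (M i) x)].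

Fixpoint fib_poly (R : nzRingType) (m : nat) : {poly R} :=
  if m is m'.+1 then
    if m' is m''.+1 then 'X * fib_poly R m' + fib_poly R m'' else 1
  else 0.

Definition bit (q i : nat) : bool := odd (q %/ 2 ^ i).

Lemma bit_eq_ex (q : nat) : exists i, bit q i == bit q i.+1.
Proof.
by exists q; rewrite /bit !divn_small// (leq_trans (ltn_expl q (ltnSn 1)))// leq_exp2l.
Qed.

Definition tfun (q : nat) : nat := ex_minn (bit_eq_ex q).

Definition coset2 (a : Z2adic) (n : nat) : set Z2adic :=
  [set a + 2 ^+ n * z | z in [set: Z2adic]].

Definition A_ (k : nat) : set Z2adic := coset2 (1 + 2 * k%:R) 3.

(* The subtraction is in Z_2: 2^(t+2) - 1 - 4k is negative for large k. *)
Definition M_ (t n k : nat) : set Z2adic :=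
  coset2 ((1 + 4 * k%:R) * 2 ^+ n) (n + t + 3) `|`
  coset2 ((2 ^+ (t + 2) - 1 - 4 * k%:R) * 2 ^+ n) (n + t + 3).

Definition component (t : nat) (i : nat + nat * nat) : set Z2adic :=
  match i with inl k => A_ k | inr (n, k) => M_ t n k end.

Definition component_index (t : nat) : set (nat + nat * nat) :=
  [set i | match i with
           | inl k => (k <= 3)%N
           | inr (n, k) => (1 <= n)%N && (k <= 2 ^ (t + 1) - 1)%N
           end].

(* Main.v *)
Require Import Defs.
From HB Require Import structures.
From mathcomp Require Import all_boot all_order all_algebra.
From mathcomp Require Import all_classical all_reals all_analysis.
From mathcomp Require Import ring zify.

(** Write F for F_m, j = m / 2 = 1 + 6 q and P = 2 ^ t.

    The engine is the 2-adic odometer.  If G shifts every point of a set E by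
    2 ^ s times an odd number, and G is an isometry of E whose difference
    quotients are 1 modulo 4, then G \o G has the same two properties with s + 1
    in place of s, because (G (G x) - G x) + (G x - x) is G x - x times
    1 + (1 + 4 e), twice an odd number.  Iterating, the 2 ^ i-th iterate of G
    shifts by 2 ^ (s + i) times an odd number for every i, so orbits visit all
    the residue classes inside x + 2 ^ s Z_2 ([odometer_on_dense]) and there are
    no periodic points ([odometer_on_aperiodic]).

    On odd points this applies to F itself with s = 3: F x = x + 8 modulo 16 and
    the difference quotients are 1 modulo 4.  Both are finite verifications,
    since F_m and its divided difference obey linear recurrences in m, and the
    values at odd points have period 24 modulo 16 and modulo 4 respectively
    ([fib_poly_odd], [fib_diff_odd]); hence the components A_k.

    On even points one has F x = x (-1 + 4 P g) with g odd and constant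
    modulo 4 ([fib_poly_even]).  Indeed F_{2 j} (2 z) = 2 z S_j, where S_j is a
    Chebyshev polynomial of the second kind evaluated at 1 + 2 z ^ 2, and the
    doubling formulas evaluate S at the index j + 1, whose 2-adic valuation is
    t + 2.  This valuation is where t comes from: the bits of q alternate up to
    position t exactly when q agrees with -1/3 = ...10101 up to there, so
    3 q + 1 = (j + 1) / 2 has valuation t + 1 ([alternating_val]).  Therefore F
    exchanges the two balls of M_{n,k}, while F \o F shifts the points of
    valuation n by 2 ^ (n + t + 3) times an odd number, and 2 ^ (n + t + 3) is the
    modulus of those balls; the odometer argument for F \o F gives minimality
    ([M_minimal]).

    The A_k and M_{n,k} partition the nonzero points, so nothing else is
    periodic or minimal: a nonempty open set contains a nonzero point, and two
    minimal components with a common point coincide. *)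

Set Implicit Arguments.
Unset Strict Implicit.
Unset Printing Implicit Defensive.

Import Order.TTheory GRing.Theory Num.Theory.

Local Open Scope classical_set_scope.
Local Open Scope ring_scope.

(** * Divisibility by powers of 2 *)

Lemma residue_nat r n : residue r%:R n = (r %% 2 ^ n)%N.
Proof.
elim: r => [|r IH]; first by rewrite mod0n residue0.
by rewrite -addn1 natrD residueD IH modnDm.
Qed.

Lemma residue_modn x n k : (residue x (k + n) %% 2 ^ k)%N = residue x k.
Proof.
elim: n => [|n IH]; first by rewrite addn0 residue_mod.
rewrite addnS -IH -[in RHS](residue_coh x (k + n)) modn_dvdm //.
by rewrite dvdn_exp2l ?leq_addr.
Qed.

(** The residues of the quotient z at level k are read off those of x at level
    n + k, which 2 ^ n divides. *)
Lemma residue_eq0 x n : residue x n = 0%N -> exists z, x = 2 ^+ n * z.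
Proof.
move=> x0; pose quo k := (residue x (n + k) %/ 2 ^ n)%N.
have quoE k : residue x (n + k) = (2 ^ n * quo k)%N.
  by rewrite mulnC divnK // /dvdn residue_modn x0.
have quo_coh k : quo k.+1 = quo k %[mod 2 ^ k].
  have := residueS x (n + k); rewrite -addnS !quoE expnD.
  by rewrite -!muln_modr => /eqP; rewrite eqn_pmul2l ?expn_gt0 // => /eqP.
exists (of_seq quo_coh); apply: Z2adic_ext => k.
by rewrite residueM -natrX residue_nat modnMm -quoE addnC residue_modn.
Qed.

Lemma coset2P a n y : coset2 a n y <-> residue y n = residue a n.
Proof.
split=> [[z _ <-]|ya].
  rewrite -natrX residueD residueM residue_nat modnn mul0n mod0n addn0.
  by rewrite residue_mod.
have [|z zE] := @residue_eq0 (y - a) n.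
  by rewrite residueD residueN ya modnDmr subnKC ?modnn // ltnW ?residue_lt.
by exists z => //; rewrite -zE addrC subrK.
Qed.

Lemma parity2 (x : Z2adic) : (exists w, x = 2 * w) \/ (exists w, x = 1 + 2 * w).
Proof.
have := residue_lt x 1; case E: (residue x 1) => [|[|//]] _.
  by left; have [w ->] := @residue_eq0 _ 1 E; exists w; rewrite expr1.
right; have [|w _ <-] := (coset2P 1 1 x).2; first by rewrite E.
by exists w; rewrite expr1.
Qed.

Lemma pow2_odd_inj m n (v w : Z2adic) :
  2 ^+ m * (1 + 2 * v) = 2 ^+ n * (1 + 2 * w) -> m = n.
Proof.
wlog le_mn : m n v w / (m <= n)%N.
  by move=> H; case: (leqP m n) => [/H|/ltnW/H H' /esym/H']; [apply|].
move=> E; apply/eqP; rewrite eqn_leq le_mn leqNgt; apply/negP => lt_mn.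
have /coset2P : coset2 (2 ^+ m) m.+1 (2 ^+ m * (1 + 2 * v)).
  by exists v => //; rewrite exprS; ring.
have /coset2P -> : coset2 0 m.+1 (2 ^+ m * (1 + 2 * v)).
  exists (2 ^+ (n - m.+1) * (1 + 2 * w)) => //.
  by rewrite E -{2}(subnK lt_mn) exprD; ring.
rewrite residue0 -natrX residue_nat modn_small ?ltn_exp2l // => /eqP.
by rewrite eq_sym expn_eq0.
Qed.

Lemma pow2_odd_neq0 n (w : Z2adic) : 2 ^+ n * (1 + 2 * w) <> 0.
Proof.
move=> E; have /coset2P : coset2 (2 ^+ n) n.+1 (2 ^+ n * (1 + 2 * w)).
  by exists w => //; rewrite exprS; ring.
rewrite E residue0 -natrX residue_nat modn_small ?ltn_exp2l //.
by move=> /eqP; rewrite eq_sym expn_eq0.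
Qed.

Lemma pow2_oddP (x : Z2adic) : x != 0 -> exists n w, x = 2 ^+ n * (1 + 2 * w).
Proof.
move=> x0; have := val2P (val2 x) x0.
rewrite leqnn => /esym/eqP/residue_eq0[z xE].
exists (val2 x); case: (parity2 z) xE => [[w ->]|[w ->]] xE; last by exists w.
have := val2P (val2 x).+1 x0; rewrite ltnn => /esym/negP[].
by apply/eqP; rewrite -(residue0 (val2 x).+1); apply/coset2P; exists w => //;
   rewrite [RHS]xE exprS; ring.
Qed.

Lemma pow2_inj n (x y : Z2adic) : 2 ^+ n * x = 2 ^+ n * y -> x = y.
Proof.
move=> E; have [/eqP|/pow2_oddP[m [w wE]]] := eqVneq (x - y) 0.
  by rewrite subr_eq0 => /eqP.
case: (@pow2_odd_neq0 (n + m) w); rewrite exprD -mulrA -wE mulrBr E; ring.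
Qed.

Lemma coset2_nat_inj n k k' (x : Z2adic) : (k < 2 ^ n)%N -> (k' < 2 ^ n)%N ->
  coset2 k%:R n x -> coset2 k'%:R n x -> k = k'.
Proof. by move=> kn k'n /coset2P E /coset2P; rewrite E !residue_nat !modn_small. Qed.

Lemma coset2_residue n (x : Z2adic) : coset2 (residue x n)%:R n x.
Proof. by apply/coset2P; rewrite residue_nat residue_mod. Qed.

(** * Odometers *)

(** Modelled on the translation by 2 ^ s times a unit.  The bound 4 in the
    difference quotients is what makes the shift of G \o G exactly twice as
    divisible; with 2 instead it could be more divisible. *)
Definition odometer_on (G : Z2adic -> Z2adic) (E : set Z2adic) s :=
  [/\ forall x z, E x -> E (x + 2 ^+ s * z),
      forall x, E x -> exists w, G x = x + 2 ^+ s * (1 + 2 * w) &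
      forall x y, E x -> E y -> exists w, G x - G y = (x - y) * (1 + 4 * w)].

Lemma odometer_on_mem G E s x : odometer_on G E s -> E x -> E (G x).
Proof. by case=> EE step _ Ex; have [w ->] := step x Ex; apply: EE. Qed.

Lemma odometer_on_sqr G E s : odometer_on G E s -> odometer_on (G \o G) E s.+1.
Proof.
move=> odoG; have [EE step lip] := odoG.
have GE x := @odometer_on_mem G E s x odoG.
split=> [x z Ex|x Ex|x y Ex Ey] /=.
- by rewrite exprSr -mulrA; apply: EE.
- have [w wE] := step x Ex; have [v] := lip _ _ (GE x Ex) Ex.
  rewrite {2 3}wE => /eqP; rewrite subr_eq => /eqP ->.
  exists (w + v + 2 * w * v); rewrite exprS; ring.
have [w wE] := lip _ _ (GE x Ex) (GE y Ey); have [v vE] := lip _ _ Ex Ey.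
by exists (v + w + 4 * v * w); rewrite wE vE; ring.
Qed.

Lemma iter_sqr (T : Type) (G : T -> T) k x : iter k (G \o G) x = iter k.*2 G x.
Proof. by elim: k => //= k ->. Qed.

(** If the target displacement z is even it is one of G \o G; if it is odd, one
    application of G makes the remaining displacement even. *)
Lemma odometer_on_dense G E s x z N : odometer_on G E s -> E x ->
  exists k w, iter k G x = x + 2 ^+ s * z + 2 ^+ (s + N) * w.
Proof.
elim: N => [|N IH] in G s x z * => odoG Ex.
  by exists 0%N, (- z); rewrite addn0 /=; ring.
have [EE step _] := odoG; have odoGG := odometer_on_sqr odoG.
have [[v ->]|[v ->]] := parity2 z.
  have [k [w]] := IH _ _ _ v odoGG Ex; rewrite iter_sqr => kE.
  by exists k.*2, w; rewrite kE addSnnS exprS; ring.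
have [u uE] := step x Ex.
have [k [w]] := IH _ _ _ (v - u) odoGG (odometer_on_mem odoG Ex).
rewrite iter_sqr -iterSr => kE.
by exists k.*2.+1, w; rewrite kE addSnnS uE exprS; ring.
Qed.

Lemma odometer_on_coset G E s x z N : odometer_on G E s -> E x ->
  exists k, coset2 (x + 2 ^+ s * z) N (iter k G x).
Proof.
move=> odoG Ex; have [k [w kE]] := odometer_on_dense z N odoG Ex.
by exists k, (2 ^+ s * w) => //; rewrite kE exprD; ring.
Qed.

(** An odd iterate shifts by an odd number of odd multiples of 2 ^ s, hence by a
    nonzero amount; an even one is a shorter iterate of G \o G. *)
Lemma odometer_on_aperiodic G E s x n : odometer_on G E s -> E x ->
  (0 < n)%N -> iter n G x <> x.
Proof.
elim/ltn_ind: n => n IH in G s x * => odoG Ex n0.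
have [EE step _] := odoG; have odoGG := odometer_on_sqr odoG.
have [nodd|neven] := boolP (odd n); last first.
  rewrite -(odd_double_half n) (negbTE neven) add0n -iter_sqr.
  by apply: (IH _ _ _ _ _ odoGG) => //; lia.
have mem k : E (iter k G x).
  by elim: k => //= k; apply: odometer_on_mem odoG.
suff [w ->] : exists w, iter n G x = x + 2 ^+ s * (1 + 2 * w).
  by move=> E0; apply: (@pow2_odd_neq0 s w); apply: (addrI x); rewrite E0 addr0.
rewrite -(odd_double_half n) nodd add1n; elim: n./2 => [|k [w kE]].
  exact: step.
have [u uE] := step _ (mem k.*2.+1); have [v vE] := step _ (mem k.*2.+2).
exists (w + u + v + 1); rewrite doubleS iterS vE iterS uE kE; ring.
Qed.

(** * Topology of the 2-adic integers and minimal components *)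

(** The norm takes only the values 0 and 2 ^- v, so being less than 2 * 2 ^- n is
    being at most 2 ^- n, also when n = 0. *)
Lemma ball_coset2 (a : Z2adic) n : ball a (2 * 2 ^- n : rat) = coset2 a n.
Proof.
apply/seteqP; split=> y; rewrite ballEmdist /=.
  rewrite -[mdist a y]/(norm2 (a - y)) -norm2N opprB => lt_n.
  suff /residue_eq0[z zE] : residue (y - a) n = 0%N.
    by exists z => //; rewrite -zE addrC subrK.
  apply/eqP; apply: contraLR lt_n => r0; rewrite -leNgt.
  have ya0 : y - a != 0.
    by apply: contraNneq r0 => ->; rewrite residue0.
  rewrite /norm2 (negbTE ya0); move: r0; rewrite -val2P // -ltnNge => lt_n.
  case: n lt_n => // n lt_n; rewrite exprS invfM mulVKf //.
  by rewrite lef_pV2 ?posrE ?exprn_gt0 // ler_eXn2l.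
move=> [z _ <-]; rewrite -[mdist _ _]/(norm2 (a - (a + 2 ^+ n * z))).
apply: (@le_lt_trans _ _ (2 ^- n)).
  have /coset2P r0 : coset2 0 n (a - (a + 2 ^+ n * z)) by exists (- z) => //; ring.
  by rewrite norm2_le r0 residue0.
by rewrite [ltRHS]mulr_natl mulr2n ltrDl invr_gt0 exprn_gt0.
Qed.

Lemma nbhs_coset2P (a : Z2adic) P : nbhs a P <-> exists n, coset2 a n `<=` P.
Proof.
split=> [/(@nbhs_ballP rat)[e /= e0 eP]|[n nP]]; last first.
  apply/(@nbhs_ballP rat); exists (2 * 2 ^- n); last by rewrite ball_coset2.
  by rewrite /= mulr_gt0 ?invr_gt0 ?exprn_gt0.
exists (Num.bound (2 / e)); apply: subset_trans eP; rewrite -ball_coset2.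
apply: le_ball; rewrite ler_pdivrMr ?exprn_gt0 // -ler_pdivrMl // mulrC.
have bd := archi_boundP (divr_ge0 (ler0n rat 2) (ltW e0)).
by apply: ltW (lt_trans bd _); rewrite -natrX ltr_nat ltn_expl.
Qed.

Definition saturated (E : set Z2adic) n := forall x z, E x -> E (x + 2 ^+ n * z).

Lemma saturated_clopen E n : saturated E n -> clopen E.
Proof.
move=> satE; suff op (D : set Z2adic) : saturated D n -> open D.
  split; first exact: op.
  rewrite -openC; apply: op => x z Ex Exz; apply: Ex.
  suff -> : x = x + 2 ^+ n * z + 2 ^+ n * (- z) by apply: satE.
  by ring.
move=> satD; rewrite openE => x Dx; apply/nbhs_coset2P; exists n => _ [z _ <-].
exact: satD.
Qed.

Lemma saturated_balls E n : saturated E n -> finite_union_of_balls E.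
Proof.
move=> satE; pose s := [seq r <- iota 0 (2 ^ n) | `[< E r%:R >]].
exists [seq (r%:R, 2 * 2 ^- n) | r <- s].
  by move=> _ /mapP[r _ ->] /=; rewrite mulr_gt0 // invr_gt0 exprn_gt0.
apply/seteqP; split=> [x Ex|x [_ /mapP[r rs ->]] /=]; last first.
  move: rs; rewrite mem_filter ball_coset2 => /andP[/asboolP Er _] [z _ <-].
  exact: satE.
have xr := coset2_residue n x.
exists ((residue x n)%:R, 2 * 2 ^- n); last by rewrite ball_coset2.
apply: map_f; rewrite mem_filter mem_iota residue_lt leq0n !andbT.
apply/asboolP; case: xr => z _ xE.
suff -> : (residue x n)%:R = x + 2 ^+ n * (- z) by apply: satE.
by rewrite -[in RHS]xE; ring.
Qed.

Definition orbit_dense (F : Z2adic -> Z2adic) (E : set Z2adic) :=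
  forall x y n, E x -> E y -> exists k, coset2 y n (iter k F x).

Lemma orbit_dense_minimal F E n : E !=set0 -> saturated E n ->
  (forall x, E x -> E (F x)) -> orbit_dense F E -> minimal_component F E.
Proof.
move=> E0 satE FE dense; split=> //; first exact: saturated_clopen satE.
- exact: saturated_balls satE.
- by move=> _ [x Ex <-]; apply: FE.
move=> x Ex y Ey V /nbhs_coset2P[k kV]; have [i iV] := dense _ _ k Ex Ey.
by exists (iter i F x); split; [exists i|apply: kV].
Qed.

(** Each of two invariant closed minimal sets is contained in the closure of the
    orbit of a common point, and that closure lies in both. *)
Lemma minimal_component_eq F E E' x : minimal_component F E ->
  minimal_component F E' -> E x -> E' x -> E = E'.
Proof.
suff sub D D' : minimal_component F D -> minimal_component F D' -> D x -> D' x ->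
    D `<=` D'.
  by move=> mE mE' Ex E'x; apply/seteqP; split; apply: sub.
move=> [_ _ _ _ minD] [_ [_ clD'] _ FD' _] Dx D'x y /(minD _ Dx) yx.
apply: clD'; move: yx; apply: closure_subset => _ [k _ <-].
by elim: k => //= k IH; apply: FD'; exists (iter k F x).
Qed.

(** The point 0 is not isolated, as 2 ^ n tends to it. *)
Lemma nonzero_mem (E : set Z2adic) : open E -> E !=set0 -> exists2 x, E x & x != 0.
Proof.
move=> opE [x Ex]; have [x0|] := eqVneq x 0; last by exists x.
move: opE; rewrite openE => /(_ _ Ex)/nbhs_coset2P[n nE].
exists (2 ^+ n); first by apply: nE; exists 1 => //; rewrite x0; ring.
by have /eqP := @pow2_odd_neq0 n 0; rewrite mulr0 addr0 mulr1.
Qed.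

(** * Fibonacci polynomials of even index at even points *)

(** The pair (c, s) stands for c + s * sqrt (T ^ 2 - 1), the j-th power of
    T + sqrt (T ^ 2 - 1); its entries are the Chebyshev polynomials of the first
    and second kinds at T, namely c = T_j and s = U_{j-1}. *)
Fixpoint cheb (R : comNzRingType) (T : R) (j : nat) : R * R :=
  if j is j'.+1 then
    let: (c, s) := cheb T j' in (T * c + (T ^+ 2 - 1) * s, T * s + c)
  else (1, 0).

Lemma cheb_add (R : comNzRingType) (T : R) i j :
  cheb T (i + j) =
    ((cheb T i).1 * (cheb T j).1 +
       (T ^+ 2 - 1) * ((cheb T i).2 * (cheb T j).2),
     (cheb T i).1 * (cheb T j).2 + (cheb T i).2 * (cheb T j).1).
Proof.
elim: i => [|i IH].
  by rewrite add0n /=; case: (cheb T j) => c s /=; congr pair; ring.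
rewrite addSn /= IH; case: (cheb T i) (cheb T j) => [c s] [c' s'] /=.
by congr pair; ring.
Qed.

(** The norm of the unit T + sqrt (T ^ 2 - 1) is 1. *)
Lemma cheb_pell (R : comNzRingType) (T : R) j :
  (cheb T j).1 ^+ 2 = 1 + (T ^+ 2 - 1) * (cheb T j).2 ^+ 2.
Proof.
elim: j => [|j] /=; first by ring.
by case: (cheb T j) => c s /= E; ring: E.
Qed.

Lemma cheb_double (R : comNzRingType) (T : R) j :
  cheb T j.*2 = (2 * (cheb T j).1 ^+ 2 - 1, 2 * (cheb T j).2 * (cheb T j).1).
Proof.
by rewrite -addnn cheb_add; congr pair; rewrite ?cheb_pell; ring: (cheb_pell T j).
Qed.

Lemma cheb_pred (R : comNzRingType) (T : R) j :
  (cheb T j).2 = T * (cheb T j.+1).2 - (cheb T j.+1).1.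
Proof. by rewrite /=; case: (cheb T j) => c s /=; ring. Qed.

Lemma fib_poly_horner (R : comNzRingType) (x : R) j :
  (fib_poly R j.+2).[x] = x * (fib_poly R j.+1).[x] + (fib_poly R j).[x].
Proof. by rewrite [fib_poly _ _.+2]/= hornerD hornerM hornerX. Qed.

(** With x = 2 z, the square of the matrix [[x, 1], [1, 0]] generating the
    Fibonacci recurrence has determinant 1 and trace x ^ 2 + 2 = 2 T. *)
Lemma fib_poly_cheb (R : comNzRingType) (z : R) j :
  let T := 1 + 2 * z ^+ 2 in
  (fib_poly R j.*2).[2 * z] = 2 * z * (cheb T j).2 /\
  (fib_poly R j.*2.+1).[2 * z] = 2 * z ^+ 2 * (cheb T j).2 + (cheb T j).1.
Proof.
move=> T; elim: j => [|j [F0 F1]]; first by rewrite /= !hornerE; split; ring.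
have F2 : (fib_poly R j.*2.+2).[2 * z] = 2 * z * (cheb T j.+1).2.
  by rewrite fib_poly_horner F0 F1 /= /T; case: (cheb _ j) => c s /=; ring.
split; first by rewrite doubleS.
rewrite doubleS fib_poly_horner F1 F2 /= /T; case: (cheb _ j) => c s /=; ring.
Qed.

Lemma cheb_mod4 (R : comNzRingType) (z : R) j : exists c s,
  cheb (1 + 2 * z ^+ 2) j = (1 + 2 * j%:R * z ^+ 2 + 4 * c, j%:R + 4 * s).
Proof.
elim: j => [|j [c [s /= ->]]]; first by exists 0, 0; congr pair; ring.
exists (j%:R * z ^+ 4 + c + 2 * z ^+ 2 * c +
        (z ^+ 2 + z ^+ 4) * (j%:R + 4 * s)).
exists (s + 2 * z ^+ 2 * s + j%:R * z ^+ 2 + c).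
by rewrite -addn1 natrD; congr pair; ring.
Qed.

(** Each doubling gains a factor 2 in precision, starting from the values modulo
    4 at an odd index B.  The factor 1 + 2 z ^ 2 comes from the first doubling,
    which multiplies the second entry by 2 + 4 B z ^ 2; to the stated precision,
    the later ones multiply it by 2. *)
Lemma cheb_pow2 (R : comNzRingType) (z : R) b r :
  let j := (2 ^ r.+1 * b.*2.+1)%N in exists c s,
  cheb (1 + 2 * z ^+ 2) j =
    (1 + 2 ^+ r.+3 * c, j%:R * (1 + 2 * z ^+ 2) + 2 ^+ r.+3 * s).
Proof.
move=> j; rewrite {}/j; elim: r => [|r [c [s IH]]].
  rewrite expn1 mul2n cheb_double.
  have [c [s ->]] := cheb_mod4 z b.*2.+1; set B : R := b.*2.+1%:R.
  exists (4 * c ^+ 2 + 2 * c * (1 + 2 * B * z ^+ 2) +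
          B * z ^+ 2 + B ^+ 2 * z ^+ 4).
  (* 4 B ^ 2 z ^ 2 = 4 B z ^ 2 modulo 8 because B ^ 2 - B = 2 B b. *)
  exists (s * (1 + 2 * B * z ^+ 2 + 4 * c) + B * c + B * b%:R * z ^+ 2).
  have BE : B = 1 + 2 * b%:R by rewrite /B -addn1 -mul2n natrD natrM addrC.
  by rewrite -[(b.*2.+1).*2]muln2 natrM -/B /= BE; congr pair; ring.
rewrite expnS -mulnA mul2n cheb_double {}IH /=; set J := (2 ^ r.+1 * _)%N.
exists (2 * c + 2 * 2 ^+ r.+2 * c ^+ 2).
exists (s + J%:R * (1 + 2 * z ^+ 2) * c + s * 2 ^+ r.+3 * c).
by rewrite -[J.*2]muln2 natrM; congr pair; rewrite !exprS; ring.
Qed.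

(** Here m = 2 (j - 1) with j = 2 ^ (r + 1) (2 b + 1).  The index j - 1 is
    reached by stepping back once from j: modulo 2 ^ (r + 3), the result
    T * (j * T) - 1 equals j - 1 because T ^ 2 = 1 modulo 4. *)
Lemma fib_poly_even (R : comNzRingType) (z : R) b r m :
  (m.+2 = 2 * (2 ^ r.+1 * b.*2.+1))%N -> exists w,
  (fib_poly R m).[2 * z] =
    2 * z * (-1 + 2 ^+ r.+1 * (1 + 2 * b%:R) + 2 ^+ r.+3 * w).
Proof.
set j := (2 ^ r.+1 * _)%N => mE.
have j0 : (0 < j)%N by rewrite muln_gt0 expn_gt0.
have -> : m = j.-1.*2 by lia.
have [-> _] := fib_poly_cheb z j.-1; rewrite cheb_pred prednK //.
have [c [s ->]] := cheb_pow2 z b r; rewrite -/j /=.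
have jE : j%:R = 2 ^+ r.+1 * (1 + 2 * b%:R) :> R.
  by rewrite /j natrM natrX -[b.*2.+1]addn1 -mul2n natrD natrM [1 + _]addrC.
exists ((1 + 2 * b%:R) * (z ^+ 2 + z ^+ 4) + s * (1 + 2 * z ^+ 2) - c).
by congr (_ * _); rewrite jE !exprS; ring.
Qed.

(** * Fibonacci polynomials modulo 16 and their divided differences modulo 4 *)

(** The divided difference of F_m at x and y, given by a recurrence so that its
    residues are computable from those of x and y, however close these are. *)
Fixpoint fib_diff (R : comNzRingType) (x y : R) (m : nat) : R :=
  if m is m'.+1 then
    if m' is m''.+1 then
      x * fib_diff x y m' + fib_diff x y m'' + (fib_poly R m').[y]
    else 0
  else 0.

Lemma fib_diffSS (R : comNzRingType) (x y : R) j :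
  fib_diff x y j.+2 =
  x * fib_diff x y j.+1 + fib_diff x y j + (fib_poly R j.+1).[y].
Proof. by []. Qed.

Lemma fib_diffP (R : comNzRingType) (x y : R) m :
  (fib_poly R m).[x] - (fib_poly R m).[y] = (x - y) * fib_diff x y m.
Proof.
elim/ltn_ind: m => -[|[|m]] IH; [rewrite /= !hornerE; ring..|].
have /eqP := IH m.+1 (ltnSn _); rewrite subr_eq => /eqP E1.
have /eqP := IH m (ltnW (ltnSn _)); rewrite subr_eq => /eqP E0.
rewrite !fib_poly_horner E1 E0 /=; ring.
Qed.

(** The recurrences on pairs of consecutive values, in natural numbers modulo M. *)
Definition fib_step M a (u : nat * nat) := (u.2, (a * u.2 + u.1) %% M)%N.
Definition diff_step M a b (u : (nat * nat) * (nat * nat)) :=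
  (fib_step M b u.1, (u.2.2, (a * u.2.2 + u.2.1 + u.1.2) %% M))%N.

Lemma residue_fib (x : Z2adic) N m :
  iter m (fib_step (2 ^ N.+1) (residue x N.+1)) (0, 1)%N =
  (residue (fib_poly Z2adic m).[x] N.+1,
   residue (fib_poly Z2adic m.+1).[x] N.+1).
Proof.
elim: m => [|m IH]; last first.
  rewrite iterS IH /fib_step fib_poly_horner; congr pair.
  by rewrite residueD residueM modnDml.
rewrite !hornerE residue0; congr pair.
by rewrite (residue_nat 1) modn_small // -{1}(expn0 2) ltn_exp2l.
Qed.

Lemma residue_fib_diff (x y : Z2adic) N m :
  iter m (diff_step (2 ^ N.+1) (residue x N.+1) (residue y N.+1))
    ((0, 1), (0, 0))%N =
  ((residue (fib_poly Z2adic m).[y] N.+1,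
    residue (fib_poly Z2adic m.+1).[y] N.+1),
   (residue (fib_diff x y m) N.+1, residue (fib_diff x y m.+1) N.+1)).
Proof.
elim: m => [|m IH].
  by rewrite -(residue_fib y N 0) -[fib_diff x y 0]/0 -[fib_diff x y 1]/0 residue0.
rewrite iterS IH /diff_step /= -(residue_fib y N m) -(residue_fib y N m.+1) iterS.
rewrite (residue_fib y N m); congr (_, (_, _)).
by rewrite modnDml -!addnA modnDml.
Qed.

Lemma iter_period (T : Type) (f : T -> T) x p k d : iter p f x = x ->
  iter (k + p * d) f x = iter k f x.
Proof.
move=> fx; rewrite iterD; congr (iter k f).
by elim: d => [|d IH]; rewrite ?muln0 // mulnS iterD IH.
Qed.

(** All the indices m = 14 + 24 d are reduced to 14 by a period of 24. *)
Lemma fib_step_check : all (fun a => odd a ==>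
  (iter 24 (fib_step (2 ^ 4) a) (0, 1) == (0, 1))%N &&
  ((iter 14 (fib_step (2 ^ 4) a) (0, 1)).1 == (a + 8) %% 2 ^ 4)%N)
  (iota 0 (2 ^ 4)).
Proof. by vm_compute. Qed.

Lemma diff_step_check : all (fun a => all (fun b =>
  (iter 24 (diff_step (2 ^ 2) a b) ((0, 1), (0, 0)) == ((0, 1), (0, 0)))%N &&
  ((iter 14 (diff_step (2 ^ 2) a b) ((0, 1), (0, 0))).2.1 ==
     if odd a || odd b then 1 else 3)%N) (iota 0 (2 ^ 2))) (iota 0 (2 ^ 2)).
Proof. by vm_compute. Qed.

Lemma fib_diff_mod4 (x y : Z2adic) d : residue (fib_diff x y (14 + 24 * d)) 2 =
  if odd (residue x 2) || odd (residue y 2) then 1%N else 3%N.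
Proof.
have := allP diff_step_check (residue x 2); rewrite mem_iota residue_lt => /(_ isT).
move=> /allP/(_ (residue y 2)); rewrite mem_iota residue_lt.
move=> /(_ isT)/andP[/eqP per /eqP <-].
have /(congr1 (fun u => u.2.1)) := residue_fib_diff x y 1 (14 + 24 * d).
by rewrite iter_period // => ->.
Qed.

Lemma odd_residue (w : Z2adic) n : odd (residue (1 + 2 * w) n.+1).
Proof.
have -> : odd (residue (1 + 2 * w) n.+1) = (residue (1 + 2 * w) 1 != 0%N).
  by rewrite -(residue_modn _ n 1) add1n expn1 modn2; case: odd.
have /coset2P -> : coset2 1 1 (1 + 2 * w) by exists w => //; ring.
by rewrite (residue_nat 1).
Qed.

Lemma even_residue (w : Z2adic) n : odd (residue (2 * w) n.+1) = false.
Proof.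
have -> : odd (residue (2 * w) n.+1) = (residue (2 * w) 1 != 0%N).
  by rewrite -(residue_modn _ n 1) add1n expn1 modn2; case: odd.
have /coset2P -> : coset2 0 1 (2 * w) by exists w => //; ring.
by rewrite residue0.
Qed.

Lemma fib_diff_odd (v w : Z2adic) d :
  exists e, fib_diff (1 + 2 * v) (1 + 2 * w) (14 + 24 * d) = 1 + 4 * e.
Proof.
have [|e _ <-] := (coset2P 1 2 (fib_diff (1 + 2 * v) (1 + 2 * w) (14 + 24 * d))).2.
  by rewrite fib_diff_mod4 odd_residue (residue_nat 1).
by exists e; ring.
Qed.

Lemma fib_diff_even (v w : Z2adic) d :
  exists e, fib_diff (2 * v) (2 * w) (14 + 24 * d) = -1 + 4 * e.
Proof.
have [|e _ <-] := (coset2P 3%:R 2 (fib_diff (2 * v) (2 * w) (14 + 24 * d))).2.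
  by rewrite fib_diff_mod4 !even_residue residue_nat.
by exists (e + 1); ring.
Qed.

Lemma fib_poly_odd (v : Z2adic) d : let x := 1 + 2 * v in
  exists w, (fib_poly Z2adic (14 + 24 * d)).[x] = x + 2 ^+ 3 * (1 + 2 * w).
Proof.
move=> x; have xodd : odd (residue x 4) := odd_residue v 3.
suff : coset2 (x + 2 ^+ 3) 4 (fib_poly Z2adic (14 + 24 * d)).[x].
  by case=> w _ <-; exists w; ring.
apply/coset2P; rewrite residueD -natrX residue_nat.
have := allP fib_step_check (residue x 4).
rewrite mem_iota residue_lt xodd => /(_ isT)/andP[/eqP per /eqP val].
have /(congr1 fst) := residue_fib x 3 (14 + 24 * d).
by rewrite iter_period // val [RHS]/= => <-.
Qed.

(** * Alternating binary digits *)

Definition alternating_to q t := (forall i, (i < t)%N -> bit q i != bit q i.+1) /\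
  bit q t = bit q t.+1.

Lemma tfunP q : alternating_to q (tfun q).
Proof.
rewrite /tfun; case: ex_minnP => t /eqP tP tmin; split=> // i.
by rewrite ltnNge; apply: contra; apply: tmin.
Qed.

Lemma bitS q i : bit q i.+1 = bit q./2 i.
Proof. by rewrite /bit expnS divnMA divn2. Qed.

Lemma bit0 q : bit q 0 = odd q.
Proof. by rewrite /bit divn1. Qed.

(** Halving q shifts its bits and, as long as they alternate, toggles the parity
    and exchanges 3 q + 1 and 3 q + 2 up to a factor 2: -1/3 and -2/3 are the two
    2-adic integers with alternating bits. *)
Lemma alternating_val q t : alternating_to q t ->
  exists b, (3 * q + (if odd q then 1 else 2) = 2 ^ t.+1 * b.*2.+1)%N.
Proof.
elim: t q => [|t IH] q [alt stop].
  move: stop; rewrite bitS !bit0 => oddE; exists (3 * q./2./2 + (odd q).*2)%N.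
  have := odd_double_half q; have := odd_double_half q./2; rewrite -oddE.
  by case: (odd q); lia.
have [|b bE] := IH q./2.
  split; last by rewrite -!bitS.
  by move=> i it; rewrite -!bitS; apply: alt.
exists b; have := alt 0%N isT; rewrite bitS !bit0; have := odd_double_half q.
by rewrite expnS -mulnA -bE; case: (odd q); case: (odd q./2) => //; lia.
Qed.

(** * The sets of the decomposition *)

Lemma A_P k (x : Z2adic) :
  A_ k x <-> exists2 c, coset2 k%:R 2 c & x = 1 + 2 * c.
Proof.
split=> [[z _ <-]|[_ [z _ <-] ->]]; last by exists z => //; ring.
by exists (k%:R + 2 ^+ 2 * z); [exists z | ring].
Qed.

(** In the coordinate c both balls of M_{n,k} become the ball of c around k of
    radius 2 ^- (t + 1): the reflection is absorbed in the sign of c. *)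
Lemma M_P t n k (x : Z2adic) : M_ t n k x <-> exists2 c, coset2 k%:R (t + 1) c &
  x = 2 ^+ n * (1 + 4 * c) \/ x = 2 ^+ n * (4 * 2 ^+ t - 1 - 4 * c).
Proof.
split=> [[] [z _ <-]|[_ [z _ <-] [] ->]].
- exists (k%:R + 2 ^+ (t + 1) * z); first by exists z.
  by left; rewrite !exprD; ring.
- exists (k%:R + 2 ^+ (t + 1) * - z); first by exists (- z).
  by right; rewrite !exprD; ring.
- by left; exists z => //; rewrite !exprD; ring.
- by right; exists (- z) => //; rewrite !exprD; ring.
Qed.

Lemma component_cover t (x : Z2adic) : x != 0 ->
  exists2 i, component_index t i & component t i x.
Proof.
move=> /pow2_oddP[[|n] [w ->]].
  exists (inl (residue w 2)); first by have := residue_lt w 2; rewrite /=; lia.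
  by apply/A_P; exists w; [apply: coset2_residue | rewrite mul1r].
suff [c wE] : exists c,
    1 + 2 * w = 1 + 4 * c \/ 1 + 2 * w = 4 * 2 ^+ t - 1 - 4 * c.
  exists (inr (n.+1, residue c (t + 1))).
    by have := residue_lt c (t + 1); rewrite /=; lia.
  by apply/M_P; exists c; [apply: coset2_residue | case: wE => <-; [left|right]].
have [[v ->]|[v ->]] := parity2 w; first by exists v; left; ring.
by exists (2 ^+ t - 1 - v); right; ring.
Qed.

Lemma component_disjoint t i j (x : Z2adic) : component_index t i ->
  component_index t j -> component t i x -> component t j x -> i = j.
Proof.
have Mpow n k : M_ t n k x -> exists w, x = 2 ^+ n * (1 + 2 * w).
  case/M_P=> c _ []->; first by exists (2 * c); congr (_ * _); ring.
  by exists (2 * 2 ^+ t - 1 - 2 * c); congr (_ * _); ring.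
have AM k n k' : A_ k x -> (1 <= n)%N -> M_ t n k' x -> False.
  case/A_P=> c _ xE n1 /Mpow[w]; rewrite xE -[1 + 2 * c]mul1r -(expr0 2).
  by move=> /pow2_odd_inj n0; rewrite -n0 in n1.
(* 1 + 4 c and 4 P - 1 - 4 c' differ modulo 4. *)
have mixed (c c' : Z2adic) : 1 + 4 * c <> 4 * 2 ^+ t - 1 - 4 * c'.
  move=> E; apply: (@pow2_odd_neq0 1 (c + c' - 2 ^+ t)).
  transitivity (1 + 4 * c - (4 * 2 ^+ t - 1 - 4 * c')); first by ring.
  by rewrite E subrr.
case: i j => [k|[n k]] [k'|[n' k']] /=.
- move=> kb k'b /A_P[c kc xE] /A_P[c' kc' xE']; congr inl.
  apply: coset2_nat_inj kc _; [lia | lia |].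
  suff -> : c = c' by [].
  apply: (@pow2_inj 1); apply: (addrI 1); rewrite expr1 -xE; exact: xE'.
- by move=> _ /andP[n1 _] Ax Mx; case: (AM _ _ _ Ax n1 Mx).
- by move=> /andP[n1 _] _ Mx Ax; case: (AM _ _ _ Ax n1 Mx).
move=> /andP[_ kb] /andP[_ k'b] Mx M'x.
have nn' : n = n'.
  have [w xE] := Mpow _ _ Mx; have [w'] := Mpow _ _ M'x.
  by rewrite xE => /pow2_odd_inj.
rewrite -{}nn' in M'x *; congr (inr (_, _)).
have four : 4 = 2 ^+ 2 :> Z2adic by rewrite -natrX.
have Pgt0 : (0 < 2 ^ (t + 1))%N by rewrite expn_gt0.
case/M_P: Mx M'x => c kc xE /M_P[c' kc' xE'].
apply: coset2_nat_inj kc _; [lia | lia |].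
suff -> : c = c' by [].
case: xE xE' => -> [] /pow2_inj E.
- by apply: (@pow2_inj 2); apply: (addrI 1); rewrite -four.
- by case: (mixed _ _ E).
- by case: (mixed _ _ (esym E)).
- apply: (@pow2_inj 2); apply: oppr_inj; apply: (addrI (4 * 2 ^+ t - 1)).
  by rewrite -four.
Qed.

Lemma component_neq0 t i : ~ component t i 0.
Proof.
case: i => [k /A_P[c _]|[n k] /M_P[c _ []] E].
- by move/esym; rewrite -[1 + _]mul1r => /(@pow2_odd_neq0 0).
- by apply: (@pow2_odd_neq0 n (2 * c)); rewrite E; ring.
- by apply: (@pow2_odd_neq0 n (2 * 2 ^+ t - 1 - 2 * c)); rewrite E; ring.
Qed.

(** * Dynamics on the components *)

(** What the minimal decomposition depends on.  In [mult_even] the multiplier of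
    x is -1 + 4 P g with P = 2 ^ t and g odd, and g is constant modulo 4 as x
    varies: the shift of F \o F involves g (x) + g (F x), which must be 2 modulo
    4. *)
Record fib_like (F : Z2adic -> Z2adic) t := FibLike {
  shift_odd : forall v, exists w, F (1 + 2 * v) = 1 + 2 * v + 2 ^+ 3 * (1 + 2 * w);
  diff_odd : forall v w, exists e,
    F (1 + 2 * v) - F (1 + 2 * w) = (1 + 2 * v - (1 + 2 * w)) * (1 + 4 * e);
  mult_even : exists b, forall v, exists w,
    F (2 * v) = 2 * v * (-1 + 4 * 2 ^+ t * (1 + 2 * b + 4 * w));
  diff_even : forall v w, exists e,
    F (2 * v) - F (2 * w) = (2 * v - 2 * w) * (-1 + 4 * e)
}.

Definition odd_multiples n : set Z2adic :=
  [set x | exists w, x = 2 ^+ n * (1 + 2 * w)].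

Lemma odd_odometer F t (fibF : fib_like F t) : odometer_on F (odd_multiples 0) 3.
Proof.
split=> [_ z [v ->]|_ [v ->]|_ _ [v ->] [w ->]]; rewrite ?mul1r.
- by exists (v + 2 ^+ 2 * z); ring.
- exact: shift_odd fibF _.
- exact: diff_odd fibF _ _.
Qed.

(** With g' = g (F x), the multiplier of x under F \o F is
    (-1 + 4 P g) (-1 + 4 P g') = 1 - 4 P (g + g') + 16 P ^ 2 g g', that is,
    1 + 8 P times an odd number.  The difference quotients are those of F, both
    -1 modulo 4, multiplied together. *)
Lemma even_odometer F t n (fibF : fib_like F t) :
  odometer_on (F \o F) (odd_multiples n.+1) (n.+1 + t + 3).
Proof.
have [b multF] := mult_even fibF.
have Fpow w : exists h, F (2 ^+ n.+1 * (1 + 2 * w)) =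
    2 ^+ n.+1 * (1 + 2 * w) * (-1 + 4 * 2 ^+ t * (1 + 2 * b + 4 * h)).
  by rewrite exprS -mulrA; apply: multF.
have oddF x : odd_multiples n.+1 x -> odd_multiples n.+1 (F x).
  move=> [w ->]; have [h ->] := Fpow w.
  by exists (- 1 - w + 2 * 2 ^+ t * (1 + 2 * b + 4 * h) * (1 + 2 * w)); ring.
have lipF x y : odd_multiples n.+1 x -> odd_multiples n.+1 y ->
    exists e, F x - F y = (x - y) * (-1 + 4 * e).
  by move=> [v ->] [w ->]; rewrite exprS -!mulrA; apply: diff_even fibF _ _.
split=> [_ z [w ->]|x xE|x y xE yE] /=.
- by exists (w + 4 * 2 ^+ t * z); rewrite !exprD; ring.
- have [v' E'] := oddF x xE; case: xE => v vE; rewrite vE in E' *.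
  have [h E] := Fpow v; have [h'] := Fpow v'; rewrite -E' => ->; rewrite E.
  pose g := 1 + 2 * b + 4 * h; pose g' := 1 + 2 * b + 4 * h'.
  pose c := - 1 - b - h - h' + 2 ^+ t * g * g'.
  by exists (v + c + 2 * v * c); rewrite /c /g /g' !exprD; ring.
have [e eE] := lipF _ _ xE yE; have [e' ->] := lipF _ _ (oddF x xE) (oddF y yE).
by exists (4 * e * e' - e - e'); rewrite eE; ring.
Qed.

Lemma fib_like_aperiodic F t x n (fibF : fib_like F t) :
  x != 0 -> (0 < n)%N -> iter n F x <> x.
Proof.
move=> /pow2_oddP[[|k] [w xE]] n0 xper.
  by apply: (odometer_on_aperiodic (odd_odometer fibF) _ n0 xper); exists w.
apply: (odometer_on_aperiodic (even_odometer k fibF) _ n0 _).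
  by exists w; apply: xE.
by rewrite iter_sqr -addnn iterD xper.
Qed.

Lemma A_minimal F t k (fibF : fib_like F t) : minimal_component F (A_ k).
Proof.
have A_odd x : A_ k x -> odd_multiples 0 x.
  by case/A_P=> c _ ->; exists c; rewrite mul1r.
have satA : saturated (A_ k) 3.
  by move=> _ z [w _ <-]; exists (w + z) => //; ring.
apply: (orbit_dense_minimal (n := 3)) => //.
- by exists (1 + 2 * k%:R); exists 0 => //; ring.
- move=> x xA; have [_ step _] := odd_odometer fibF.
  have [w ->] := step x (A_odd x xA).
  exact: satA.
move=> x y n xA yA; have xodd := A_odd x xA.
case: xA yA xodd => [z _ xE] [z' _ <-] xodd.
have [i iP] := odometer_on_coset (z' - z) n (odd_odometer fibF) xodd.
exists i; suff <- : x + 2 ^+ 3 * (z' - z) = 1 + 2 * k%:R + 2 ^+ 3 * z' by [].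
by rewrite -[in LHS]xE; ring.
Qed.

(** F exchanges the balls B1 and B2, and F \o F is an odometer on each, so a
    target in the ball of x is reached by even iterates and a target in the other
    ball by odd ones. *)
Lemma M_minimal F t n k (fibF : fib_like F t) : minimal_component F (M_ t n.+1 k).
Proof.
pose P : Z2adic := 2 ^+ t.
pose B1 x := exists2 c, coset2 k%:R (t + 1) c & x = 2 ^+ n.+1 * (1 + 4 * c).
pose B2 x := exists2 c, coset2 k%:R (t + 1) c & x = 2 ^+ n.+1 * (4 * P - 1 - 4 * c).
have MB x : M_ t n.+1 k x <-> B1 x \/ B2 x.
  split=> [/M_P[c cP []]|[] [c cP xE]]; first by left; exists c.
  - by right; exists c.
  - by apply/M_P; exists c; [|left].
  - by apply/M_P; exists c; [|right].
have M_odd x : M_ t n.+1 k x -> odd_multiples n.+1 x.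
  case/M_P=> c _ [] ->; first by exists (2 * c); ring.
  by exists (2 * P - 1 - 2 * c); rewrite /P; ring.
have [b multF] := mult_even fibF.
have Fpow w : exists h, F (2 ^+ n.+1 * w) =
    2 ^+ n.+1 * w * (-1 + 4 * P * (1 + 2 * b + 4 * h)).
  by rewrite exprS -mulrA; apply: multF.
(* In the coordinate c, F adds P (1 - g - 4 g c) on B1 and
   P (- 1 - g + 4 g (P - c)) on B2, multiples of 2 P since g is odd. *)
have F12 x : B1 x -> B2 (F x).
  case=> c [z _ cE ->]; have [h ->] := Fpow (1 + 4 * c).
  pose g := 1 + 2 * b + 4 * h.
  exists (c + 2 * P * (- b - 2 * h - 2 * g * c)); last by rewrite /g; ring.
  by exists (z - b - 2 * h - 2 * g * c) => //; rewrite -cE /P exprD; ring.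
have F21 x : B2 x -> B1 (F x).
  case=> c [z _ cE ->]; have [h ->] := Fpow (4 * P - 1 - 4 * c).
  pose g := 1 + 2 * b + 4 * h; pose e := - 1 - b - 2 * h + 2 * g * (P - c).
  exists (c + 2 * P * e); last by rewrite /e /g; ring.
  by exists (z + e) => //; rewrite -cE /P exprD; ring.
have same1 x y : B1 x -> B1 y -> exists z, y = x + 2 ^+ (n.+1 + t + 3) * z.
  case=> _ [z _ <-] -> [_ [z' _ <-] ->]; exists (z' - z).
  by rewrite !exprD; ring.
have same2 x y : B2 x -> B2 y -> exists z, y = x + 2 ^+ (n.+1 + t + 3) * z.
  case=> _ [z _ <-] -> [_ [z' _ <-] ->]; exists (z - z').
  by rewrite !exprD; ring.
have FM x : M_ t n.+1 k x -> M_ t n.+1 k (F x).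
  by case/MB=> [/F12|/F21] Bx; apply/MB; [right|left].
apply: (orbit_dense_minimal (n := n.+1 + t + 3)) => //.
- exists (2 ^+ n.+1 * (1 + 4 * k%:R)); apply/M_P; exists k%:R; last by left.
  by apply/coset2P.
- move=> x w [] [z _ <-]; [left|right].
  + by exists (z + w) => //; ring.
  + by exists (z + w) => //; ring.
have near x y N : M_ t n.+1 k x -> (exists z, y = x + 2 ^+ (n.+1 + t + 3) * z) ->
    exists i, coset2 y N (iter i F x).
  move=> /M_odd xodd [z ->].
  have [i iP] := odometer_on_coset z N (even_odometer n fibF) xodd.
  by exists i.*2; rewrite -iter_sqr.
have far x y N : M_ t n.+1 k x -> (exists z, y = F x + 2 ^+ (n.+1 + t + 3) * z) ->
    exists i, coset2 y N (iter i F x).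
  move=> /FM FMx /(near _ _ N FMx)[i iP].
  by exists i.+1; rewrite iterSr.
move=> x y N xM yM; case/MB: (xM) => Bx; case/MB: yM => By.
- by apply: near xM _; apply: same1.
- by apply: far xM _; apply: same2 => //; apply: F12.
- by apply: far xM _; apply: same1 => //; apply: F21.
- by apply: near xM _; apply: same2.
Qed.

Lemma fib_like_component F t i (fibF : fib_like F t) : component_index t i ->
  minimal_component F (component t i).
Proof.
case: i => [k _|[[|n] k] //= _]; first exact: A_minimal fibF.
exact: M_minimal fibF.
Qed.

Lemma fib_poly_fib_like q d t : (q = 1 + 2 * d)%N -> t = tfun q ->
  fib_like (horner (fib_poly Z2adic (2 + 12 * q))) t.
Proof.
move=> qE tE; have mE : (2 + 12 * q = 14 + 24 * d)%N by lia.
have [b bE] := alternating_val (tfunP q).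
have {}bE : ((2 + 12 * q).+2 = 2 * (2 ^ t.+2 * b.*2.+1))%N.
  rewrite [(2 ^ t.+2)%N]expnS tE -mulnA -bE.
  have -> : odd q by rewrite qE oddD oddM.
  by lia.
split=> [v|v w||v w]; rewrite ?mE.
- exact: fib_poly_odd.
- by have [e eE] := fib_diff_odd v w d; exists e; rewrite -eE fib_diffP.
- exists b%:R => v; have [w wE] := fib_poly_even v bE.
  by exists w; rewrite -mE wE !exprS; congr (_ * _); ring.
- by have [e eE] := fib_diff_even v w d; exists e; rewrite -eE fib_diffP.
Qed.

Theorem theorem5p2 (m q d t : nat) (hm : m = (2 + 12 * q)%N)
    (hq : q = (1 + 2 * d)%N) (ht : t = tfun q) :
  [/\ minimal_decomposition (fib_poly Z2adic m) [set 0]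
        (component_index t) (component t) set0,
      [set: Z2adic] =
        [set 0] `|` ((\bigcup_(k in [set k | (k <= 3)%N]) A_ k) `|`
          (\bigcup_(n in [set n | (1 <= n)%N])
             \bigcup_(k in [set k | (k <= 2 ^ (t + 1) - 1)%N]) M_ t n k)) &
      (fib_poly Z2adic m).[0] = 0].
Proof.
have fibF := fib_poly_fib_like hq ht; rewrite -hm in fibF.
have F0 : (fib_poly Z2adic m).[0] = 0.
  have [b multF] := mult_even fibF; have [w] := multF 0; rewrite mulr0 mul0r; exact.
have minM := fib_like_component fibF.
split=> //.
- rewrite /minimal_decomposition /=; split=> //.
  + rewrite !setU0 !setI0; split=> //.
      apply/esym/seteqP; split=> // x _; have [->|x0] := eqVneq x 0; first by left.
      by right; have [i Di xi] := component_cover t x0; exists i.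
    by apply/seteqP; split=> // x [-> [i Di] /component_neq0]; apply.
  + split; last exact: finite_set1.
    apply/seteqP; split=> [_ ->|x [n n0 xper]]; first by exists 1%N.
    apply: contrapT => /eqP x0; exact: (fib_like_aperiodic fibF x0 n0 xper).
  + split=> //.
    by move=> i j Di Dj [x [xi xj]]; apply: component_disjoint Di Dj xi xj.
    move=> E minE; have [E0 [opE _] _ _ _] := minE.
    have [x Ex x0] := nonzero_mem opE E0; have [i Di xi] := component_cover t x0.
    by exists i => //; apply: minimal_component_eq minE (minM i Di) Ex xi.
- apply/esym/seteqP; split=> // x _; have [->|x0] := eqVneq x 0; first by left.
  right; have [[k|[n k]] Di xi] := component_cover t x0; first by left; exists k.
  by right; case/andP: Di => n1 kb; exists n => //; exists k.
Qed.
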